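(* Let $(L^k,g)$ and $(M^n,h)$ be oriented Riemannian manifolds with $k\le n$, let $\alpha\in\Omega^k(M)$ be a calibration (not necessarily closed), and let $u\colon L\to M$ be a smooth map. Let $f$ be a smooth positive function on $L$ and let $\tilde g=f^2g$. Then $u\colon(L,g)\to(M,h)$ is a Smith immersion with respect to $\alpha$ if and only if $u\colon(L,\tilde g)\to(M,h)$ is a Smith immersion with respect to $\alpha$. That is, the Smith immersion equations are invariant under conformal scaling of the domain metric.
   Context: A form $\alpha\in\Omega^k(M)$ is a calibration if $\alpha(e_1,\dots,e_k)\le 1$ for all orthonormal $e_1,\dots,e_k\in T_xM$, $x\in M$. A smooth map $u\colon(L^k,g)\to(M^n,h)$ is a Smith immersion with respect to $\alpha$ if $u^*\alpha=\lambda^k\,\mathrm{vol}_L$ and $u^*h=\lambda^2g$ at all points of $L$, where $\lambda=\frac{1}{\sqrt k}|du|$, $|du|^2=\operatorname{tr}_g(u^*h)$, and $\mathrm{vol}_L$ is the Riemannian volume form of $g$. *)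

(* Defs.v *)
From HB Require Import structures.
From mathcomp Require Import all_boot all_order all_algebra.
From mathcomp Require Import all_classical all_reals all_analysis.

Set Implicit Arguments.
Unset Strict Implicit.
Unset Printing Implicit Defensive.

Import Order.TTheory GRing.Theory Num.Theory.
Import numFieldNormedType.Exports.

Local Open Scope classical_set_scope.
Local Open Scope ring_scope.

Section Smoothness.
Context {R : realType} {V W : normedModType R}.

(* Meant for open [U] and finite-dimensional [V]; there, [Cr_on r U f] is the
   usual notion of a map of class C^r on [U]. *)
Fixpoint Cr_on (r : nat) (U : set V) (f : V -> W) : Prop :=
  match r with
  | 0 => forall x, U x -> {for x, continuous f}
  | r'.+1 => (forall x, U x -> differentiable f x) /\
             forall v, Cr_on r' U (fun x => 'D_v f x)
  end.

Definition smooth_on (U : set V) (f : V -> W) : Prop := forall r, Cr_on r U f.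

End Smoothness.

Section SmoothProduct.
Context {R : realType} {V : normedModType R}.

Lemma near_eq_differentiable (W : normedModType R) (f g : V -> W) (a : V) :
  {near a, f =1 g} -> differentiable f a -> differentiable g a.
Proof.
move=> fg /diff_locallyP[cdf fE].
have ga : f a = g a by exact: (nbhs_singleton fg).
have gE : g \o shift a = cst (g a) + 'd f a +o_ 0 id.
  apply/eqaddoP => e e0; move/eqaddoP: fE => /(_ e e0).
  apply: filter_app.
  have : \forall x \near (0 : V), f (x + a) = g (x + a).
    by have := fg; rewrite (near_shift 0) subr0.
  apply: filter_app; near=> x => /= fgx.
  by rewrite /GRing.add /= /cst /= ga fgx.
apply/diff_locallyP; rewrite (diff_unique cdf gE); split => //.
Unshelve. all: by end_near. Qed.

Lemma eq_Cr_on (W : normedModType R) r (U : set V) (f g : V -> W) :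
  open U -> (forall x, U x -> f x = g x) -> Cr_on r U f -> Cr_on r U g.
Proof.
move=> oU; elim: r f g => [|r IH] f g fg /=.
  move=> cf x Ux; rewrite /prop_for /continuous_at -(fg _ Ux).
  apply: (cvg_trans _ (cf x Ux)); apply: near_eq_cvg.
  by near=> y; apply/fg; near: y; exact: open_nbhs_nbhs.
have near_fg x : U x -> {near x, f =1 g}.
  by move=> Ux; near=> y; apply: fg; near: y; exact: open_nbhs_nbhs.
move=> [df Df]; split.
  by move=> x Ux; exact: near_eq_differentiable (near_fg x Ux) (df x Ux).
move=> v; apply: IH (Df v) => x Ux.
by apply: near_eq_derive; exact: near_fg.
Unshelve. all: by end_near. Qed.

Lemma Cr_onS (W : normedModType R) r (U : set V) (f : V -> W) :
  Cr_on r.+1 U f -> Cr_on r U f.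
Proof.
elim: r f => [|r IH] f [df Df] /=.
  by move=> x Ux; exact: differentiable_continuous (df x Ux).
by split=> // v; exact: IH (Df v).
Qed.

Lemma Cr_onD (W : normedModType R) r (U : set V) (f g : V -> W) : open U ->
  Cr_on r U f -> Cr_on r U g -> Cr_on r U (f \+ g).
Proof.
move=> oU; elim: r f g => [|r IH] f g /=.
  by move=> cf cg x Ux; apply: cvgD; [exact: cf | exact: cg].
move=> [df Df] [dg Dg]; split=> [x Ux|v].
  by apply: differentiableD; [exact: df | exact: dg].
apply: eq_Cr_on (IH _ _ (Df v) (Dg v)) => // x Ux /=.
by rewrite deriveD //; apply: diff_derivable; [exact: df | exact: dg].
Qed.

Lemma Cr_onM r (U : set V) (f g : V -> R) : open U ->
  Cr_on r U f -> Cr_on r U g -> Cr_on r U (f \* g).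
Proof.
move=> oU; elim: r f g => [|r IH] f g.
  by move=> cf cg x Ux; apply: cvgM; [exact: cf | exact: cg].
move=> Cf Cg; have [df Df] := Cf; have [dg Dg] := Cg.
split=> [x Ux|v].
  by apply: differentiableM; [exact: df | exact: dg].
have := Cr_onD oU (IH _ _ (Cr_onS Cf) (Dg v)) (IH _ _ (Cr_onS Cg) (Df v)).
apply: eq_Cr_on => // x Ux /=.
by rewrite deriveM //; apply: diff_derivable; [exact: df | exact: dg].
Qed.

Lemma smooth_onM (U : set V) (f g : V -> R) : open U ->
  smooth_on U f -> smooth_on U g -> smooth_on U (f \* g).
Proof. by move=> oU sf sg r; exact: Cr_onM. Qed.

End SmoothProduct.

Section Manifolds.
Context {R : realType}.

Record chart (n : nat) (T : topologicalType) := Chart {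
  chart_fun :> T -> 'rV[R]_n;
  chart_inv : 'rV[R]_n -> T;
  chart_dom : set T;
  chart_dom_open : open chart_dom;
  chart_img_open : open (chart_fun @` chart_dom);
  chart_funK : forall p, chart_dom p -> chart_inv (chart_fun p) = p;
  chart_fun_continuous : {within chart_dom, continuous chart_fun};
  chart_inv_continuous :
    {within chart_fun @` chart_dom, continuous chart_inv} }.

(* [atlas] need not be maximal: every notion below depends on it only through
   the smooth structure it generates.  [chart_at] picks a chart around each
   point; it only serves to represent tangent vectors by coordinates. *)
Record manifold (n : nat) := Manifold {
  carrier :> topologicalType;
  manifold_hausdorff : hausdorff_space carrier;
  manifold_second_countable : @second_countable carrier;
  atlas : set (chart n carrier);
  chart_at : carrier -> chart n carrier;
  chart_at_atlas : forall p, atlas (chart_at p);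
  chart_at_dom : forall p, chart_dom (chart_at p) p;
  atlas_compatible : forall phi psi, atlas phi -> atlas psi ->
    smooth_on (phi @` (chart_dom phi `&` chart_dom psi))
              (psi \o chart_inv phi) }.

(* The tangent space at [p], a vector being given by its components in the
   chart [chart_at p]. *)
Definition tangent n (M : manifold n) (p : M) : normedModType R := 'rV[R]_n.

(* The i-th coordinate vector at [p] of a chart [phi] around [p]. *)
Definition coord_vector n (M : manifold n) (phi : chart n M) (p : M)
    (i : 'I_n) : tangent p :=
  'd (chart_at p \o chart_inv phi) (phi p) (delta_mx 0 i).

Definition smooth_function n (M : manifold n) (f : M -> R) : Prop :=
  forall phi, atlas phi -> smooth_on (phi @` chart_dom phi) (f \o chart_inv phi).

Definition smooth_map k n (L : manifold k) (M : manifold n) (u : L -> M) : Prop :=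
  continuous u /\
  forall phi psi, atlas phi -> atlas psi ->
    smooth_on (phi @` (chart_dom phi `&` u @^-1` chart_dom psi))
              (psi \o u \o chart_inv phi).

Definition tangent_map k n (L : manifold k) (M : manifold n) (u : L -> M)
    (p : L) : tangent p -> tangent (u p) :=
  'd (chart_at (u p) \o u \o chart_inv (chart_at p)) (chart_at p p).

Record metric n (M : manifold n) := Metric {
  metric_fun :> forall p : M, tangent p -> tangent p -> R;
  metric_linear : forall p (a : R) (v v' w : tangent p),
    metric_fun (a *: v + v') w = a * metric_fun v w + metric_fun v' w;
  metric_sym : forall p (v w : tangent p), metric_fun v w = metric_fun w v;
  metric_gt0 : forall p (v : tangent p), v != 0 -> 0 < metric_fun v v;
  metric_smooth : forall phi, atlas phi -> forall i j,
    smooth_on (phi @` chart_dom phi)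
      (fun x => let p := chart_inv phi x in
        metric_fun (coord_vector phi p i) (coord_vector phi p j)) }.

Record diff_form n (M : manifold n) (k : nat) := DiffForm {
  form_fun :> forall p : M, ('I_k -> tangent p) -> R;
  form_linear : forall p (v : 'I_k -> tangent p) i (a : R) (x y : tangent p),
    form_fun (dfwith v i (a *: x + y)) =
    a * form_fun (dfwith v i x) + form_fun (dfwith v i y);
  form_alternating : forall p (v : 'I_k -> tangent p) i j,
    i != j -> v i = v j -> form_fun v = 0;
  form_smooth : forall phi, atlas phi -> forall I : 'I_k -> 'I_n,
    smooth_on (phi @` chart_dom phi)
      (fun x => let p := chart_inv phi x in
        form_fun (fun a => coord_vector phi p (I a))) }.

Definition frame_mx n (M : manifold n) (p : M) (v : 'I_n -> tangent p) :
    'M[R]_n := \matrix_(i, j) (v i : 'rV[R]_n) 0 j.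

Definition frame_det n (M : manifold n) (p : M) (v : 'I_n -> tangent p) : R :=
  \det (frame_mx v).

(* An orientation of each tangent space, recorded as the sign [orient_sign p]
   of the coordinate basis of [tangent p], and locally constant in the
   coordinate frames of each chart. *)
Record orientation n (M : manifold n) := Orientation {
  orient_sign :> M -> R;
  orient_signP : forall p, orient_sign p = 1 \/ orient_sign p = -1;
  orient_locally_constant : forall phi p, atlas phi -> chart_dom phi p ->
    \forall q \near p,
      (0 < orient_sign q * frame_det (coord_vector phi q)) =
      (0 < orient_sign p * frame_det (coord_vector phi p)) }.

Definition positive_frame n (M : manifold n) (o : orientation M) (p : M)
    (v : 'I_n -> tangent p) : Prop := 0 < o p * frame_det v.

Definition orthonormal n (M : manifold n) (g : metric M) (p : M) m
    (e : 'I_m -> tangent p) : Prop :=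
  forall i j, g p (e i) (e j) = (i == j)%:R.

(* The matrix of a bilinear form in the coordinate basis of [tangent p]. *)
Definition gram n (M : manifold n) (p : M) (b : tangent p -> tangent p -> R) :
    'M[R]_n :=
  \matrix_(i, j) b (delta_mx 0 i) (delta_mx 0 j).

(* g^{ij} b_{ij} *)
Definition metric_trace n (M : manifold n) (g : metric M) (p : M)
    (b : tangent p -> tangent p -> R) : R :=
  \tr (invmx (gram (g p)) *m gram b).

(* sqrt(det(g_{ij})) dx^1 /\ ... /\ dx^n in positively oriented coordinates; see
   [volume_form_orthonormal]. *)
Definition volume_form n (M : manifold n) (o : orientation M) (g : metric M)
    (p : M) (v : 'I_n -> tangent p) : R :=
  o p * Num.sqrt (\det (gram (g p))) * frame_det v.

Definition pullback_metric k n (L : manifold k) (M : manifold n) (u : L -> M)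
    (h : metric M) (p : L) (v w : tangent p) : R :=
  h (u p) (tangent_map u v) (tangent_map u w).

Definition pullback_form k n m (L : manifold k) (M : manifold n) (u : L -> M)
    (alpha : diff_form M m) (p : L) (v : 'I_m -> tangent p) : R :=
  alpha (u p) (fun i => tangent_map u (v i)).

Definition calibration n (M : manifold n) (h : metric M) k
    (alpha : diff_form M k) : Prop :=
  forall (p : M) (e : 'I_k -> tangent p), orthonormal h e -> alpha p e <= 1.

(* |du|_{g,h} *)
Definition tangent_map_norm k n (L : manifold k) (M : manifold n) (g : metric L)
    (h : metric M) (u : L -> M) (p : L) : R :=
  Num.sqrt (metric_trace g (pullback_metric u h (p := p))).

Definition smith_factor k n (L : manifold k) (M : manifold n) (g : metric L)
    (h : metric M) (u : L -> M) (p : L) : R :=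
  (Num.sqrt k%:R)^-1 * tangent_map_norm g h u p.

Definition smith_immersion k n (L : manifold k) (M : manifold n)
    (oL : orientation L) (g : metric L) (h : metric M) (alpha : diff_form M k)
    (u : L -> M) : Prop :=
  smooth_map u /\
  forall p : L,
    (forall v : 'I_k -> tangent p,
      pullback_form u alpha v =
      smith_factor g h u p ^+ k * volume_form oL g v) /\
    (forall v w : tangent p,
      pullback_metric u h v w = smith_factor g h u p ^+ 2 * g p v w).

Section Conformal.
Context {n : nat} {M : manifold n} (f : M -> R) (g : metric M).
Hypotheses (f_smooth : smooth_function f) (f_gt0 : forall p, 0 < f p).

Definition conformal_fun (p : M) (v w : tangent p) : R := f p ^+ 2 * g p v w.

Fact conformal_linear (p : M) (a : R) (v v' w : tangent p) :
  conformal_fun (a *: v + v') w = a * conformal_fun v w + conformal_fun v' w.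
Proof. by rewrite /conformal_fun metric_linear mulrDr mulrCA. Qed.

Fact conformal_sym (p : M) (v w : tangent p) :
  conformal_fun v w = conformal_fun w v.
Proof. by rewrite /conformal_fun metric_sym. Qed.

Fact conformal_gt0 (p : M) (v : tangent p) : v != 0 -> 0 < conformal_fun v v.
Proof. by move=> v0; rewrite mulr_gt0 ?exprn_gt0 ?metric_gt0. Qed.

Fact conformal_smooth phi : atlas phi -> forall i j,
  smooth_on (phi @` chart_dom phi)
    (fun x => let p := chart_inv phi x in
      conformal_fun (coord_vector phi p i) (coord_vector phi p j)).
Proof.
move=> Aphi i j; have oU := @chart_img_open _ _ phi.
have sf := f_smooth Aphi.
exact (smooth_onM oU (smooth_onM oU sf sf) (metric_smooth g Aphi i j)).
Qed.

Definition conformal_metric : metric M :=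
  Metric conformal_linear conformal_sym conformal_gt0 conformal_smooth.

End Conformal.

Section Sanity.
Context {n : nat} {M : manifold n} (g : metric M) (p : M).

Let gram_frame (b : tangent p -> tangent p -> R) (e : 'I_n -> tangent p) :
  (forall a v v' w, b (a *: v + v') w = a * b v w + b v' w) ->
  (forall v w, b v w = b w v) ->
  frame_mx e *m gram b *m (frame_mx e)^T = \matrix_(i, j) b (e i) (e j).
Proof.
move=> bl bs.
have b0 w : b 0 w = 0.
  have /eqP := bl 1 0 0 w.
  by rewrite scale1r addr0 mul1r -subr_eq0 opprD addrA subrr sub0r oppr_eq0 => /eqP.
have bsum m (c : 'I_m -> R) (x : 'I_m -> tangent p) w :
    b (\sum_i c i *: x i) w = \sum_i c i * b (x i) w.
  elim/big_rec2: _ => [|i s t _ <-]; [exact: b0 | exact: bl].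
have eE i : e i = \sum_j (e i : 'rV[R]_n) 0 j *: (delta_mx 0 j : tangent p).
  exact: (row_sum_delta (e i : 'rV[R]_n)).
apply/matrixP => i j; rewrite !mxE [in RHS](eE i) bsum.
rewrite (eq_bigr (fun l => \sum_m frame_mx e i m * gram b m l * frame_mx e j l)).
  rewrite exchange_big /=; apply: eq_bigr => m _.
  rewrite bs [in RHS](eE j) bsum mulr_sumr; apply: eq_bigr => l _.
  by rewrite !mxE -mulrA; congr (_ * _); rewrite mulrC bs.
by move=> l _; rewrite !mxE mulr_suml; apply: eq_bigr => m _; rewrite !mxE.
Qed.

Let gram_orthonormal (e : 'I_n -> tangent p) : orthonormal g e ->
  frame_mx e *m gram (g p) *m (frame_mx e)^T = 1%:M.
Proof.
move=> on; rewrite gram_frame; [|exact: metric_linear|exact: metric_sym].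
by apply/matrixP => i j; rewrite !mxE on.
Qed.

Lemma volume_form_orthonormal (o : orientation M) (e : 'I_n -> tangent p) :
  orthonormal g e -> positive_frame o e -> volume_form o g e = 1.
Proof.
move=> on; rewrite /positive_frame /volume_form => pos.
have detE : frame_det e ^+ 2 * \det (gram (g p)) = 1.
  by have /(congr1 determinant) := gram_orthonormal on;
     rewrite !det_mulmx det_tr det1 mulrAC -expr2.
have o2 : o p ^+ 2 = 1.
  by case: (orient_signP o p) => ->; rewrite ?sqrrN expr1n.
have fd0 : 0 < frame_det e ^+ 2.
  by rewrite exprn_even_gt0 //=; apply: contraTneq pos => ->; rewrite mulr0 ltxx.
have -> : \det (gram (g p)) = (frame_det e ^+ 2)^-1.
  by apply: (mulfI (lt0r_neq0 fd0)); rewrite detE divff ?lt0r_neq0.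
have -> : (frame_det e ^+ 2)^-1 = ((o p * frame_det e)^-1) ^+ 2.
  by rewrite exprVn exprMn o2 mul1r.
by rewrite sqrtr_sqr ger0_norm ?invr_ge0 ?ltW // mulrAC divff ?lt0r_neq0.
Qed.

Lemma metric_trace_orthonormal (b : tangent p -> tangent p -> R)
    (e : 'I_n -> tangent p) :
  (forall a v v' w, b (a *: v + v') w = a * b v w + b v' w) ->
  (forall v w, b v w = b w v) -> orthonormal g e ->
  metric_trace g b = \sum_i b (e i) (e i).
Proof.
move=> bl bs on; have onE := gram_orthonormal on.
have [uE _] := mulmx1_unit (etrans (mulmxA _ _ _) onE).
have gE : (frame_mx e)^T *m frame_mx e *m gram (g p) = 1%:M.
  by rewrite -mulmxA; apply: mulmx1C.
have [_ uG] := mulmx1_unit gE.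
have -> : metric_trace g b = \tr ((frame_mx e)^T *m frame_mx e *m gram b).
  congr (\tr (_ *m _)).
  by rewrite -[LHS]mul1mx -gE mulmxK.
rewrite -mulmxA mxtrace_mulC gram_frame //.
by apply: eq_bigr => i _; rewrite mxE.
Qed.

End Sanity.

End Manifolds.
Arguments manifold R n : clear implicits.
Arguments conformal_metric {R n M} f g f_smooth f_gt0.

(* Main.v *)
Require Import Defs.
From HB Require Import structures.
From mathcomp Require Import all_boot all_order all_algebra.
From mathcomp Require Import all_classical all_reals all_analysis.

Import Order.TTheory GRing.Theory Num.Theory.

Local Open Scope ring_scope.

(** Under [g ~> f^2 g] the factor [lambda] scales by [f^-1] and the volume form
by [f^k], so both [lambda^k vol_L] and [lambda^2 g] are unchanged pointwise. *)

(** The left sides [u^*alpha] and [u^*h] of the Smith equations do not involve the domain metric, so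
    only the right sides have to be compared. The Gram matrix of [g] is multiplied by [f^2]: its
    inverse gives the trace a factor [f^-2], hence [lambda] a factor [f^-1] after the square root,
    while its determinant gives the volume form a factor [sqrt (f^(2k)) = f^k]. The cancellations
    are [smith_volume_conformal] and [smith_metric_conformal]. *)

Section MetricGram.
Context {R : realType} {n : nat} {M : manifold R n} (g : metric M) (p : M).

Lemma metric0l (w : tangent p) : g p 0 w = 0.
Proof.
have /eqP := metric_linear g 1 0 0 w.
by rewrite scale1r addr0 mul1r -subr_eq0 opprD addNKr oppr_eq0 => /eqP.
Qed.

Lemma metric_sum_coord (v w : tangent p) :
  g p v w = \sum_i (v : 'rV[R]_n) 0 i * g p (delta_mx 0 i) w.
Proof.
rewrite [in LHS](row_sum_delta (v : 'rV[R]_n)).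
elim/big_rec2: _ => [|i s t _ <-]; [exact: metric0l | exact: metric_linear].
Qed.

(** Positive definiteness gives trivial kernel. This is what lets [invmx] scale in
    [metric_trace_conformal], since [invmx] is the true inverse only on [unitmx]. *)
Lemma gram_unitmx : gram (g p) \in unitmx.
Proof.
rewrite -row_free_unit; apply: inj_row_free => v vG.
have ve j : g p v (delta_mx 0 j) = 0.
  have /matrixP/(_ 0 j) := vG; rewrite !mxE => <-.
  by rewrite metric_sum_coord; apply: eq_bigr => i _; rewrite mxE.
(* For [v != 0] the expansion of [g p v v > 0] in its first slot would have only zero terms, by
   [ve]. *)
apply: contra_eq (metric_sum_coord v v) => v0.
rewrite big1 => [|i _]; first by rewrite gt_eqF// metric_gt0.
by rewrite Defs.metric_sym ve mulr0.
Qed.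

End MetricGram.

Section ConformalScaling.
Context {R : realType} {k : nat} {L : manifold R k} (g : metric L) (f : L -> R).
Hypotheses (f_smooth : smooth_function f) (f_gt0 : forall p : L, 0 < f p).

Let fg := conformal_metric f g f_smooth f_gt0.

Lemma gram_conformal (p : L) : gram (fg p) = f p ^+ 2 *: gram (g p).
Proof. by apply/matrixP => i j; rewrite !mxE. Qed.

Lemma metric_trace_conformal (p : L) (b : tangent p -> tangent p -> R) :
  metric_trace fg b = (f p)^-1 ^+ 2 * metric_trace g b.
Proof.
have fp0 : f p ^+ 2 != 0 by rewrite expf_neq0// gt_eqF.
rewrite /metric_trace gram_conformal invmxZ.
  by rewrite -scalemxAl mxtraceZ exprVn.
by rewrite unitmxZ ?unitfE// gram_unitmx.
Qed.

Lemma volume_form_conformal (o : orientation L) (p : L)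
    (v : 'I_k -> tangent p) :
  volume_form o fg v = f p ^+ k * volume_form o g v.
Proof.
(* [(f^2)^k] is regrouped as [(f^k)^2] so that the square root yields [f^k]; positivity of [f]
   removes the absolute value. *)
rewrite /volume_form gram_conformal detZ -exprM mulnC exprM sqrtrM ?sqr_ge0//.
by rewrite sqrtr_sqr ger0_norm ?exprn_ge0 ?ltW// (mulrCA (o p)) !mulrA.
Qed.

Lemma smith_factor_conformal {n : nat} {M : manifold R n} (h : metric M)
    (u : L -> M) (p : L) :
  smith_factor fg h u p = (f p)^-1 * smith_factor g h u p.
Proof.
rewrite /smith_factor /tangent_map_norm metric_trace_conformal.
by rewrite sqrtrM ?sqr_ge0// sqrtr_sqr ger0_norm ?invr_ge0 ?ltW// mulrCA.
Qed.

(** The degree of the form equals the dimension of [L], so the [k]-th power of [f^-1] meets exactly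
    the [f^k] of the volume form. *)
Lemma smith_volume_conformal {n : nat} {M : manifold R n} (h : metric M)
    (u : L -> M) (o : orientation L) (p : L) (v : 'I_k -> tangent p) :
  smith_factor fg h u p ^+ k * volume_form o fg v =
  smith_factor g h u p ^+ k * volume_form o g v.
Proof.
rewrite smith_factor_conformal volume_form_conformal mulrA -exprMn (mulrAC (f p)^-1).
by rewrite mulVf ?mul1r// gt_eqF.
Qed.

Lemma smith_metric_conformal {n : nat} {M : manifold R n} (h : metric M)
    (u : L -> M) (p : L) (v w : tangent p) :
  smith_factor fg h u p ^+ 2 * fg p v w = smith_factor g h u p ^+ 2 * g p v w.
Proof.
rewrite smith_factor_conformal /= /conformal_fun mulrA -exprMn (mulrAC (f p)^-1).
by rewrite mulVf ?mul1r// gt_eqF.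
Qed.

End ConformalScaling.

Theorem mainTheorem3 (R : realType) (k n : nat) (hkn : (k <= n)%N)
    (L : manifold R k) (M : manifold R n)
    (oL : orientation L) (oM : orientation M) (g : metric L) (h : metric M)
    (alpha : diff_form M k) (halpha : calibration h alpha)
    (u : L -> M) (hu : smooth_map u)
    (f : L -> R) (f_smooth : smooth_function f) (f_gt0 : forall p : L, 0 < f p) :
  smith_immersion oL g h alpha u <->
  smith_immersion oL (conformal_metric f g f_smooth f_gt0) h alpha u.
Proof.
(* Smoothness of [u] is independent of the metric and comes from [hu]. *)
split=> -[_ smith]; split=> // p; have [form_eq metric_eq] := smith p.
  by split=> [v|v w]; rewrite ?smith_volume_conformal ?smith_metric_conformal.
split=> [v|v w]; first by rewrite form_eq smith_volume_conformal.
by rewrite metric_eq smith_metric_conformal.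
Qed.
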